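(* Let $G$ be a quadrangulation of an orientable surface. Then $G$ admits no proper vertex-$4$-coloring such that the number of rainbow-faces of $G$ is odd.
   Context: All graphs are loopless and finite. A cycle is a connected $2$-regular graph. An orientable surface here means a sphere with $k\ge 0$ attached handles. A quadrangulation of such a surface is a $2$-edge-connected graph embedded on the surface such that every face boundary is a cycle of length four. A vertex-coloring is proper if any two adjacent vertices receive different colors; a proper vertex-$4$-coloring of $G$ is a proper vertex-coloring $g: V(G)\to\{1,2,3,4\}$. Given such a coloring, a face of $G$ is a rainbow-face if all four distinct colors appear on its boundary.
   Formalization: The embedding is taken to be cellular (every face an open disc), given by a rotation system; otherwise the claim fails: a noncontractible 4-cycle on the torus coloured 1,2,3,4 has a single, annular face bounded by that 4-cycle, so exactly one rainbow-face. *)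

(* Defs.v *)
From mathcomp Require Import all_boot all_fingroup.

Set Implicit Arguments.
Unset Strict Implicit.
Unset Printing Implicit Defensive.

(* Finite loopless graphs, parallel edges allowed. The boolean merely names the
   two ends of an edge; it carries no orientation. *)
Record mgraph := MGraph {
  vertex : finType;
  edge : finType;
  ends : edge -> bool -> vertex;
  loopless : forall e, ends e false != ends e true
}.

Section Graph.

Variable G : mgraph.
Implicit Types (W : {set vertex G}) (F : {set edge G}).

Definition incident (v : vertex G) (e : edge G) : bool :=
  [exists b, ends e b == v].

Definition adj_by F : rel (vertex G) :=
  [rel u v | [exists e in F, (u != v) && incident u e && incident v e]].

Definition adjacent : rel (vertex G) := adj_by setT.

(* In the next two definitions the pair (W, F) stands for the subgraph with
   vertex set W and edge set F; the ends of the edges in F are in W. *)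
Definition connected W F : bool :=
  (W != set0) && [forall u in W, forall v in W, connect (adj_by F) u v].

Definition is_cycle W F : bool :=
  connected W F && [forall v in W, #|[set e in F | incident v e]| == 2].

Definition two_edge_connected : bool :=
  (1 < #|vertex G|) && [forall F : {set edge G}, (#|F| < 2) ==> connected setT (~: F)].

Definition proper_coloring (C : eqType) (g : vertex G -> C) : Prop :=
  forall u v, adjacent u v -> g u != g v.

(* The dart (e, b) is the edge e traversed from its end b to its other end. *)
Definition dart := (edge G * bool)%type.

Definition source (d : dart) : vertex G := ends d.1 d.2.

Definition rev (d : dart) : dart := (d.1, ~~ d.2).

Lemma revK : involutive rev.
Proof. by case=> e b; rewrite /rev /= negbK. Qed.

(* An embedding in an oriented closed surface is given by its rotation system:
   rot cyclically permutes the darts leaving each vertex, in the order in which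
   they occur around that vertex. Gluing a disc along each orbit of face_perm
   below recovers the surface, which for connected G is the sphere with k
   handles where #|V| - #|E| + #|faces| = 2 - 2k; every cellular embedding of a
   connected graph with an edge in such a surface arises in this way. *)
Record embedding := Embedding {
  rot : {perm dart};
  rotP : forall d, porbit rot d = [set d' | source d' == source d]
}.

Variable M : embedding.

(* After d, the boundary of the face along d continues with the dart that
   follows rev d in the rotation at the vertex which d enters. *)
Definition face_perm : {perm dart} := (perm (inv_inj revK) * rot M)%g.

Definition faces : {set {set dart}} := porbits face_perm.

Definition boundary_vertices (f : {set dart}) : {set vertex G} := source @: f.

Definition boundary_edges (f : {set dart}) : {set edge G} :=
  [set d.1 | d in f].

Definition quadrangulation : Prop :=
  two_edge_connected /\
  forall f, f \in faces ->
    is_cycle (boundary_vertices f) (boundary_edges f) /\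
    #|boundary_edges f| = 4.

Definition rainbow (g : vertex G -> 'I_4) (f : {set dart}) : bool :=
  [forall c, exists v in boundary_vertices f, g v == c].

Definition rainbow_faces (g : vertex G -> 'I_4) : {set {set dart}} :=
  [set f in faces | rainbow g f].

End Graph.

(* Main.v *)
Require Import Defs.
From mathcomp Require Import all_boot all_fingroup.
From mathcomp Require Import ssralg zmodp.

Set Implicit Arguments.
Unset Strict Implicit.
Unset Printing Implicit Defensive.

Import GRing.Theory.

(* Restores [rev] and [rot] of Defs, shadowed by the operations on sequences. *)
Import Defs.

(** Give the ordered pairs of colors the antisymmetric weight with values in
    Z/4 that is 1 on (1,2), (2,3), (3,1) and 0 on pairs containing 0. A closed
    walk of length 4 in K_4 has weight 2 if it visits all four colors (in either
    direction) and weight 0 otherwise. Each edge of the graph is traversed once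
    in each direction by the oriented face boundaries, so the weights of the
    faces add up to 0: twice the number of rainbow faces is 0 modulo 4. *)

Definition color_weight (a b : 'I_4) : 'Z_4 :=
  let pos := [:: (1, 2); (2, 3); (3, 1)] in
  if (val a, val b) \in pos then 1%R
  else if (val b, val a) \in pos then (- 1)%R else 0%R.

Lemma color_weightC a b : (color_weight a b + color_weight b a = 0)%R.
Proof.
by apply/eqP; case: a b => [[|[|[|[|?]]]] ?] [[|[|[|[|?]]]] ?].
Qed.

Lemma color_weight_walk4 a b c d :
  a != b -> b != c -> c != d -> d != a ->
  (color_weight a b + color_weight b c + color_weight c d + color_weight d a
   = if uniq [:: a; b; c; d] then 2%:R else 0)%R.
Proof.
move=> ab bc cd da; apply/eqP; move: ab bc cd da.
by case: a b c d => [[|[|[|[|?]]]] ?] [[|[|[|[|?]]]] ?]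
  [[|[|[|[|?]]]] ?] [[|[|[|[|?]]]] ?].
Qed.

(** Pigeonhole. With four corners and four colors, it turns distinctness of the corner colors into
    the rainbow condition. *)
Lemma uniq_all_mem (T : finType) (s : seq T) :
  size s = #|T| -> uniq s = [forall x, x \in s].
Proof.
move=> size_s; apply/idP/forallP => [/card_uniqP card_s x | all_s].
  by rewrite (subset_cardP _ (subset_predT (mem s))) // card_s.
by apply/card_uniqP; rewrite size_s; apply: eq_card => x; rewrite all_s.
Qed.

Section Faces.

Variables (G : mgraph) (M : embedding G).
Implicit Types (d x y : dart G) (f : {set dart G}).

Let p := face_perm M.

Lemma source_rev_neq d : source (rev d) != source d.
Proof.
case: d => e []; rewrite /source /=; first exact: loopless.
by rewrite eq_sym loopless.
Qed.

Lemma source_rot d : source (rot M d) = source d.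
Proof.
apply/eqP; have := mem_porbit (rot M) 1 d.
by rewrite rotP inE expg1.
Qed.

Lemma face_permE d : p d = rot M (rev d).
Proof. by rewrite /p /face_perm permM permE. Qed.

Lemma source_face_perm d : source (p d) = source (rev d).
Proof. by rewrite face_permE source_rot. Qed.

Lemma dart_edge_eq d d' : d.1 = d'.1 -> d' = d \/ d' = rev d.
Proof.
by case: d d' => [e b] [e' b'] /= <-; rewrite /rev; case: b b' => [] []; auto.
Qed.

(** As there are no loops, the two darts of an edge start at different vertices. *)
Lemma dart_eq d d' : d.1 = d'.1 -> source d = source d' -> d = d'.
Proof.
move=> /dart_edge_eq[-> // | ->] /eqP.
by rewrite eq_sym (negbTE (source_rev_neq d)).
Qed.

Lemma incident_dart d : incident (source d) d.1.
Proof. by apply/existsP; exists d.2. Qed.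

Section TwoRegular.

Variable f : {set dart G}.
Hypothesis f_face : f \in faces M.
Hypothesis deg2 : forall v, v \in boundary_vertices f ->
  #|[set e in boundary_edges f | incident v e]| = 2.

Lemma face_perm_closed d : (p d \in f) = (d \in f).
Proof.
case/imsetP: f_face => d0 _ ->.
by rewrite -!eq_porbit_mem -/p (porbit_perm p 1 d).
Qed.

(** Turning back along the same edge would make [rev d] a fixed point of the rotation, so [d.1]
    would be the only edge at that vertex, against degree 2. *)
Lemma face_turn d : d \in f -> (p d).1 != d.1.
Proof.
move=> df; apply/eqP => same.
have pd : p d = rev d by apply: dart_eq; rewrite ?source_face_perm.
have vf : source (rev d) \in boundary_vertices f.
  by rewrite -pd imset_f // face_perm_closed.
have /eqP := deg2 vf; apply/negP; rewrite neq_ltn ltnS.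
rewrite -[1](cards1 d.1) subset_leq_card //; apply/subsetP => e.
rewrite !inE => /andP[_ /existsP[b /eqP eb]].
have : (e, b) \in porbit (rot M) (rev d) by rewrite rotP inE /source eb.
case/porbitP => i; rewrite permX.
have -> : iter i (rot M) (rev d) = rev d.
  by elim: i => //= i ->; rewrite -face_permE.
by case=> ->.
Qed.

(* If the walk from d reaches rev d, then, the boundary being 2-regular at the
   end of d, the dart before rev d is rev (p d), so the walk from p d reaches
   rev (p d) two steps sooner. *)
Lemma face_no_reversal k d : d \in f -> iter k p d != rev d.
Proof.
elim/ltn_ind: k d => -[_ d _|[_ d df|k IH d df]].
(* The descent is by two steps, hence two base cases: [d] is not its own reverse, and [p d] leaves
   the edge of [d]. *)
- by apply: contraNneq (source_rev_neq d) => /= <-.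
- by apply: contraNneq (face_turn df) => /= ->.
have pdf : p d \in f by rewrite face_perm_closed.
apply: contraNneq (IH k (leqnSn _) (p d) pdf); rewrite iterS -iterSr.
set y := iter _ p d => py.
have yf : y \in f by rewrite /y; elim: k.+1 => //= i; rewrite face_perm_closed.
have vy : source (rev y) = source (rev d) by rewrite -source_face_perm py.
have inc x : x \in f -> source (rev x) = source (rev d) ->
    x.1 \in [set e in boundary_edges f | incident (source (rev d)) e].
  by move=> xf <-; rewrite inE imset_f //= (incident_dart (rev x)).
have vf : source (rev d) \in boundary_vertices f.
  by rewrite -source_face_perm imset_f.
have y_pd : y.1 = (p d).1.
  (* The edges of [y], [d] and [p d] all lie among the two boundary edges [a], [b] at this vertex,
     and those of [y] and [p d] both differ from that of [d]. *)
  have /eqP/cards2P[a [b [_ ab]]] := deg2 vf.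
  have := inc d df erefl; have := inc y yf vy.
  have : (p d).1 \in [set e in boundary_edges f | incident (source (rev d)) e].
    by rewrite inE imset_f //= -source_face_perm incident_dart.
  have := face_turn df; have := face_turn yf; rewrite py /= ab !inE.
  move=> dy pdd /orP[] /eqP pdE /orP[] /eqP yE /orP[] /eqP dE;
    move: dy pdd; by rewrite pdE yE dE ?eqxx.
apply/eqP; rewrite -(revK y); congr rev; apply: dart_eq => //.
by rewrite vy source_face_perm.
Qed.

(** Two distinct darts of [f] on one edge would be mutually reverse, which [face_no_reversal]
    excludes. So a face with four edges is an orbit of exactly four darts. *)
Lemma card_boundary_edges : #|boundary_edges f| = #|f|.
Proof.
apply: card_in_imset => d d' df d'f /dart_edge_eq[-> // | d'E].
have d'p : d' \in porbit p d.
  move: df d'f; case/imsetP: f_face => d0 _ ->; rewrite -!eq_porbit_mem -/p.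
  by move=> /eqP -> /eqP ->.
case/porbitP: d'p => k; rewrite permX => d'k.
by have := face_no_reversal k df; rewrite -d'k d'E eqxx.
Qed.

End TwoRegular.

Lemma quadrangulation_card_face f :
  quadrangulation M -> f \in faces M -> #|f| = 4.
Proof.
case=> _ quad ff; have [/andP[_ /forall_inP deg2] <-] := quad f ff.
by rewrite card_boundary_edges // => v /deg2/eqP.
Qed.

Variable g : vertex G -> 'I_4.

Definition dart_weight d : 'Z_4 :=
  color_weight (g (source d)) (g (source (rev d))).

Lemma sum_dart_weight : (\sum_d dart_weight d = 0)%R.
Proof.
transitivity (\sum_e \sum_b dart_weight (e, b))%R.
  by rewrite pair_bigA; apply: eq_bigr => -[].
by rewrite big1 // => e _; rewrite big_bool /dart_weight /= color_weightC.
Qed.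

Hypothesis g_proper : proper_coloring g.

Lemma proper_dart d : g (source d) != g (source (rev d)).
Proof.
apply: g_proper; apply/exists_inP; exists d.1; first by rewrite inE.
by rewrite eq_sym source_rev_neq incident_dart (incident_dart (rev d)).
Qed.

Lemma face_weight f : f \in faces M -> #|f| = 4 ->
  (\sum_(d in f) dart_weight d = if rainbow g f then 2%:R else 0)%R.
Proof.
case/imsetP=> d _ -> {f}; rewrite -/p => card4.
have := uniq_traject_porbit p d; have := iter_porbit p d.
have := porbit_traject p d; rewrite card4 => mem_f p4 uniq_f.
rewrite (eq_bigl _ _ mem_f) -big_uniq //=.
rewrite !big_cons big_nil addr0 !addrA /dart_weight.
(* Each dart ends where its successor starts, and the fourth successor is [d] again: the sum is that
   of a closed walk through four colors. *)
rewrite -!source_face_perm [p (p (p (p d)))]p4.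
have step x : g (source x) != g (source (p x)).
  by rewrite source_face_perm proper_dart.
have last_step : g (source (p (p (p d)))) != g (source d).
  by rewrite -[X in _ != g (source X)]p4 step.
rewrite color_weight_walk4 //; congr (if _ then _ else _).
rewrite uniq_all_mem ?card_ord //; apply: eq_forallb => c.
transitivity (c \in map (g \o @source G) (traject p d 4)) => //.
apply/mapP/exists_inP => [[x xf ->] | [_ /imsetP[x xf ->] /eqP <-]].
  by exists (source x) => //; rewrite imset_f // mem_f.
by exists x; rewrite // -mem_f.
Qed.

End Faces.

Theorem corollary2 (G : mgraph) (M : embedding G) (hM : quadrangulation M) :
  ~ (exists g : vertex G -> 'I_4,
       proper_coloring g /\ odd #|rainbow_faces M g|).
Proof.
case=> g [g_proper]; apply/negP.
have sum0 := sum_dart_weight g.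
have : (\sum_(f in faces M) \sum_(d in f) dart_weight g d = 0)%R.
  (* The faces, as orbits of [face_perm], partition the darts. *)
  rewrite -[RHS]sum0 (partition_big (porbit (face_perm M)) [in faces M]) /=;
    last by move=> d _; rewrite imset_f.
  apply: eq_bigr => _ /imsetP[d _ ->]; apply: eq_bigl => d'.
  by rewrite -eq_porbit_mem eq_sym.
under eq_bigr => f ff do
  rewrite (face_weight g_proper ff (quadrangulation_card_face hM ff)).
rewrite -big_mkcondr /= (eq_bigl [in rainbow_faces M g]); last first.
  by move=> f; rewrite !inE.
rewrite sumr_const -mulrnA => /(congr1 val).
(* Vanishing in Z/4 means that 4 = 2 * 2 divides twice the number of rainbow faces; cancel a factor
   2. *)
rewrite /= val_Zp_nat // => /eqP; rewrite -/(dvdn _ _) (@dvdn_pmul2l 2 2) //.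
by rewrite dvdn2.
Qed.
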